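(* Let $\mathscr{B}\in\mathcal{L}^{m+p}$ be a controllable system. Let $L,T\in\mathbb{Z}_{>0}$ with $L\ge \bm{n}(\mathscr{B})$. Let $(\hat u_{[1,T]},\hat y_{[1,T]})=\{(\hat u_j,\hat y_j)\}_{j=1}^T\subset\mathbb{R}^{m+p}$ be a $T$-length trajectory of $\mathscr{B}$, and assume that $\hat u_{[1,T]}$ is $L$-Page exciting of order $\bm{n}(\mathscr{B})+1$. Then $(u_{[1,L]},y_{[1,L]})=\mathrm{col}(u_1,\dots,u_L,y_1,\dots,y_L)\in\mathscr{B}_L$ if and only if there exists a vector $g\in\mathbb{R}^{\lfloor T/L\rfloor}$ such that $$\begin{pmatrix}\mathscr{P}_L(\hat u_{[1,T]})\\ \mathscr{P}_L(\hat y_{[1,T]})\end{pmatrix} g=\begin{pmatrix}u_{[1,L]}\\ y_{[1,L]}\end{pmatrix}.$$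
   Context: Notation: $\mathrm{col}(a_1,\dots,a_k)$ is the stacked column vector $(a_1^\top,\dots,a_k^\top)^\top$; $u_{[1,T]}=\mathrm{col}(u_1,\dots,u_T)$. Systems. A dynamical system is a triple $(\mathbb{Z}_{\ge0},\mathbb{W},\mathscr{B})$ with behaviour $\mathscr{B}\subseteq\mathbb{W}^{\mathbb{Z}_{\ge 0}}$. $\mathcal{L}^{m+p}$ is the class of systems with $\mathbb{W}=\mathbb{R}^{m+p}$ such that $\mathscr{B}$ is a linear subspace, is time invariant ($\sigma\mathscr{B}\subseteq\mathscr{B}$, where $(\sigma w)(t)=w(t+1)$ and $\sigma\mathscr{B}=\{\sigma w\mid w\in\mathscr{B}\}$), and is complete (closed in the topology of pointwise convergence). A system is identified with its behaviour. Every trajectory is written $w=\mathrm{col}(u,y)$ with inputs $u_t\in\mathbb{R}^m$ and outputs $y_t\in\mathbb{R}^p$, and $\mathscr{B}$ admits input/output/state representations, i.e. there are a state dimension $n$ and real matrices $A,B,C,D$ with $$\mathscr{B}=\mathscr{B}(A,B,C,D):=\{\mathrm{col}(u,y)\in(\mathbb{R}^{m+p})^{\mathbb{Z}_{\ge0}}\mid \exists x\in(\mathbb{R}^n)^{\mathbb{Z}_{\ge0}}:\ \sigma x=Ax+Bu,\ y=Cx+Du\}.$$ $\bm{n}(\mathscr{B})$ is the smallest state dimension among all such representations. Restricted behaviour: $\mathscr{B}_T=\{w\in(\mathbb{R}^{m+p})^T\mid \exists v\in\mathscr{B}: w_t=v_t,\ 1\le t\le T\}$; its elements are called $T$-length trajectories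 of $\mathscr{B}$. Trajectories in $\mathscr{B}_T$ are identified, up to reordering of entries, with vectors $\mathrm{col}(u_1,\dots,u_T,y_1,\dots,y_T)$. Controllable: for every $T\in\mathbb{Z}_{>0}$, $w^1\in\mathscr{B}_T$, $w^2\in\mathscr{B}$ there exist $w\in\mathscr{B}$ and $T'\in\mathbb{Z}_{>0}$ such that $w_t=w^1_t$ for $1\le t\le T$ and $w_t=w^2_{t-T-T'}$ for $t>T+T'$. Page matrix of depth $L$ of a vector sequence $u_{[1,T]}$: the matrix $\mathscr{P}_L(u_{[1,T]})$ with $\lfloor T/L\rfloor$ columns whose $j$-th column is $\mathrm{col}(u_{(j-1)L+1},u_{(j-1)L+2},\dots,u_{jL})$, $j=1,\dots,\lfloor T/L\rfloor$. For a subsequence $u_{[a,b]}=(u_a,\dots,u_b)$, the matrix $\mathscr{P}_L(u_{[a,b]})$ is defined in the same way after re-indexing. $L$-Page exciting of order $M$: the sequence $u_{[1,T]}\subset\mathbb{R}^m$ is $L$-Page exciting of order $M$ if the vertical concatenation of the $M$ matrices $\mathscr{P}_L(u_{[1,T-(M-1)L]}),\ \mathscr{P}_L(u_{[L+1,T-(M-2)L]}),\ \dots,\ \mathscr{P}_L(u_{[L(M-1)+1,T]})$ has full row rank. *)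

(* Defs.v *)
From mathcomp Require Import all_boot all_order all_algebra.
From mathcomp Require Import all_classical all_reals all_analysis.
Set Implicit Arguments.
Unset Strict Implicit.
Unset Printing Implicit Defensive.
Import Order.TTheory GRing.Theory Num.Theory.
Import numFieldNormedType.Exports.
Local Open Scope classical_set_scope.
Local Open Scope ring_scope.

(* Trajectories are functions on nat, with values col(u_t, y_t) in R^(m+p);
   a behaviour, identified with the system it defines, is a set of them. *)
Definition behaviour (R : realType) (m p : nat) : Type :=
  set (nat -> 'cV[R]_(m + p)).

Definition shift (W : Type) (w : nat -> W) : nat -> W := fun t => w t.+1.

Definition linear_behaviour (R : realType) (m p : nat)
    (B : behaviour R m p) : Prop :=
  B (fun=> 0) /\
  forall (a : R) (v w : nat -> 'cV[R]_(m + p)),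
    B v -> B w -> B (fun t => a *: v t + w t).

Definition time_invariant (R : realType) (m p : nat)
    (B : behaviour R m p) : Prop :=
  @shift _ @` B `<=` B.

Definition complete_behaviour (R : realType) (m p : nat)
    (B : behaviour R m p) : Prop :=
  closed (B : set {ptws nat -> 'cV[R]_(m + p)}).

Definition lti (R : realType) (m p : nat) (B : behaviour R m p) : Prop :=
  [/\ linear_behaviour B, time_invariant B & complete_behaviour B].

Definition iso_behaviour (R : realType) (m p n : nat)
    (A : 'M[R]_n) (Bu : 'M[R]_(n, m)) (C : 'M[R]_(p, n)) (D : 'M[R]_(p, m)) :
    behaviour R m p :=
  [set w | exists x : nat -> 'cV[R]_n, forall t : nat,
     x t.+1 = A *m x t + Bu *m usubmx (w t) /\
     dsubmx (w t) = C *m x t + D *m usubmx (w t)].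

Definition has_iso_rep (R : realType) (m p : nat) (B : behaviour R m p)
    (n : nat) : Prop :=
  exists (A : 'M[R]_n) (Bu : 'M[R]_(n, m)) (C : 'M[R]_(p, n))
    (D : 'M[R]_(p, m)), B = iso_behaviour A Bu C D.

(* n(B); the default value 0 of xget is used only if B has no representation
   at all, see state_orderP. *)
Definition state_order (R : realType) (m p : nat) (B : behaviour R m p) : nat :=
  xget 0%N [set n | has_iso_rep B n /\
                    forall n' : nat, has_iso_rep B n' -> (n <= n')%N].

Lemma state_orderP (R : realType) (m p : nat) (B : behaviour R m p) :
  (exists n, has_iso_rep B n) ->
  has_iso_rep B (state_order B) /\
  forall n : nat, has_iso_rep B n -> (state_order B <= n)%N.
Proof.
move=> [n0 Bn0].
have ex : exists n, `[< has_iso_rep B n >] by exists n0; apply/asboolP.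
rewrite /state_order.
have := @xgetPex _ 0%N [set n | has_iso_rep B n /\
  forall n' : nat, has_iso_rep B n' -> (n <= n')%N].
apply; case: (ex_minnP ex) => n /asboolP Bn minn; exists n; split=> // n' Bn'.
by apply: minn; apply/asboolP.
Qed.

(* A finite sequence w_1, ..., w_T is a function on 'I_T: the ordinal i stands
   for the index i + 1.  Trajectories of a behaviour start at time 0, but the
   window defining its T-length trajectories is {1, ..., T}. *)
Definition restricted (R : realType) (m p : nat) (B : behaviour R m p)
    (T : nat) : set ('I_T -> 'cV[R]_(m + p)) :=
  [set w | exists2 v, B v & forall i : 'I_T, w i = v i.+1].

Definition controllable (R : realType) (m p : nat) (B : behaviour R m p) :
    Prop :=
  forall (T : nat) (w1 : 'I_T -> 'cV[R]_(m + p)) (w2 : nat -> 'cV[R]_(m + p)),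
    (0 < T)%N -> restricted B w1 -> B w2 ->
    exists (w : nat -> 'cV[R]_(m + p)) (T' : nat),
      [/\ B w, (0 < T')%N,
          (forall i : 'I_T, w i.+1 = w1 i) &
          (forall t : nat, (T + T' < t)%N -> w t = w2 (t - T - T')%N)].

Definition stack (R : realType) (q L : nat) (u : 'I_L -> 'cV[R]_q) :
    'cV[R]_(\sum_(i < L) q) :=
  \mxcol_(i < L) u i.

Lemma page_index_subproof (T L : nat) (j : 'I_(T %/ L)) (i : 'I_L) :
  (j * L + i < T)%N.
Proof.
apply: leq_trans (leq_divM T L).
apply: (@leq_trans (j.+1 * L)); last by rewrite leq_mul2r ltn_ord orbT.
by rewrite mulSn addnC ltn_add2r ltn_ord.
Qed.

Definition page_index (T L : nat) (j : 'I_(T %/ L)) (i : 'I_L) : 'I_T :=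
  Ordinal (page_index_subproof j i).

(* The i-th block row of the Page matrix has columns u_(jL + i), so that its
   j-th column is the stacked vector of the j-th page. *)
Definition page_mx (R : realType) (q T L : nat) (u : 'I_T -> 'cV[R]_q) :
    'M[R]_(\sum_(i < L) q, T %/ L) :=
  \mxcol_(i < L) \matrix_(r < q, j < T %/ L) u (page_index j i) r 0.

Lemma col_page_mx (R : realType) (q T L : nat) (u : 'I_T -> 'cV[R]_q)
    (j : 'I_(T %/ L)) :
  col j (page_mx L u) = stack (fun i => u (page_index j i)).
Proof.
by apply/colP => s; rewrite !mxE.
Qed.

Lemma window_index_subproof (T L M : nat) (k : 'I_M)
    (t : 'I_(T - M.-1 * L)) :
  (k * L + t < T)%N.
Proof.
have kM : (k <= M.-1)%N by rewrite -ltnS (ltn_predK (ltn_ord k)) ltn_ord.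
have : (k * L <= M.-1 * L)%N by rewrite leq_mul2r kM orbT.
have := ltn_ord t; rewrite ltn_subRL => ltT kL.
by apply: leq_ltn_trans ltT; rewrite leq_add2r.
Qed.

(* For 0 <= k < M, the subsequence u_[kL + 1, T - (M - 1 - k)L], of length
   T - (M - 1)L; the truncated difference makes it empty if T < (M - 1)L. *)
Definition window (V : Type) (T L M : nat) (u : 'I_T -> V) (k : 'I_M) :
    'I_(T - M.-1 * L) -> V :=
  fun t => u (Ordinal (window_index_subproof k t)).

Definition page_exciting (R : realType) (m T : nat) (L M : nat)
    (u : 'I_T -> 'cV[R]_m) : Prop :=
  row_free (\mxcol_(k < M) page_mx L (window (L := L) u k)).

(* Main.v *)
Require Import Defs.
From mathcomp Require Import all_boot all_order all_algebra.
From mathcomp Require Import all_classical all_reals all_analysis.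
Set Implicit Arguments.
Unset Strict Implicit.
Unset Printing Implicit Defensive.
Import Order.TTheory GRing.Theory Num.Theory.
Import numFieldNormedType.Exports.
Local Open Scope classical_set_scope.
Local Open Scope ring_scope.

(** Cut a trajectory with state [x] into pages: the state at the start of page
    [j.+1] is [A ^+ L] times the state at the start of page [j] plus a linear
    image of the input page. Page excitation of order [n.+1] then shows that a
    row vector annihilating every pair (initial state, input page) vanishes on
    inputs and, since [n <= L], on the reachable subspace. As the first state of
    any window lies in that subspace, by duality every window is the combination
    of the data pages that matches its initial state and its inputs. *)

(** * Cayley-Hamilton, state recursions and excitation *)

Lemma mx_power_relation (F : fieldType) (n : nat) (A : 'M[F]_n) :
  exists2 c : nat -> F, c n = 1 & \sum_(i < n.+1) c i *: A ^+ i = 0.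
Proof.
exists (fun i => (char_poly A)`_i).
  by have /monicP := char_poly_monic A; rewrite lead_coefE size_char_poly.
case: n A => [|n] A; first by rewrite flatmx0.
rewrite -[RHS](Cayley_Hamilton A) -[in RHS](coefK (char_poly A)) poly_def.
rewrite size_char_poly linear_sum; apply: eq_bigr => i _.
by rewrite /= linearZ rmorphXn /= horner_mx_X.
Qed.

(** From [i = n] on, Cayley-Hamilton writes [A ^+ i] through the [n] preceding powers. *)
Lemma mx_power_vanish (F : fieldType) (n q r : nat) (A : 'M[F]_n)
    (X : 'M[F]_(q, n)) (Y : 'M[F]_(n, r)) :
  (forall i, (i < n)%N -> X *m A ^+ i *m Y = 0) ->
  forall i, X *m A ^+ i *m Y = 0.
Proof.
move=> XAY0; have [c cn1 cA0] := mx_power_relation A.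
elim/ltn_ind=> i IHi; have [/XAY0 // | le_ni] := ltnP i n.
have: X *m (A ^+ (i - n) * \sum_(k < n.+1) c k *: A ^+ k) *m Y = 0.
  by rewrite cA0 mulr0 mulmx0 mul0mx.
rewrite mulr_sumr mulmx_sumr mulmx_suml big_ord_recr /= cn1 scale1r.
rewrite -exprD subnK // big1 ?add0r // => k _.
rewrite -mulmxE -scalemxAr mulmxE -exprD -scalemxAr -scalemxAl IHi ?scaler0 //.
by rewrite -{2}(subnK le_ni) ltn_add2l.
Qed.

(** Variation of constants. The recursion is assumed only on the steps crossed, since at page level
    it stops with the data. *)
Lemma state_solution (F : fieldType) (n q : nat) (A : 'M[F]_n)
    (G : 'M[F]_(n, q)) (x : nat -> 'cV[F]_n) (u : nat -> 'cV[F]_q) (t k : nat) :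
  (forall s, (t <= s < t + k)%N -> x s.+1 = A *m x s + G *m u s) ->
  x (t + k)%N =
    A ^+ k *m x t + \sum_(s < k) A ^+ (k.-1 - s) *m G *m u (t + s)%N.
Proof.
elim: k => [|k IHk] xS; first by rewrite addn0 big_ord0 addr0 mul1mx.
rewrite addnS xS ?leq_addr ?addnS //= IHk; last first.
  by move=> s /andP[le_ts lt_s]; rewrite xS // le_ts addnS ltnW.
rewrite mulmxDr mulmxA mulmxE -exprS -addrA big_ord_recr /= subnn mul1mx.
congr (_ + (_ + _)); rewrite mulmx_sumr; apply: eq_bigr => s _.
rewrite !mulmxA mulmxE -exprS; congr (A ^+ _ *m _ *m _).
by case: k s {IHk xS} => [[]//|k] s; rewrite /= subSn // -ltnS.
Qed.

Lemma state_annihilator (F : fieldType) (n q r : nat) (A : 'M[F]_n)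
    (G : 'M[F]_(n, q)) (a : 'M[F]_(r, n))
    (x : nat -> 'cV[F]_n) (u : nat -> 'cV[F]_q) (t k : nat) :
  (forall s, x s.+1 = A *m x s + G *m u s) -> x t = 0 ->
  (forall i, a *m A ^+ i *m G = 0) -> a *m x (t + k)%N = 0.
Proof.
move=> xS xt0 aAG0; rewrite (@state_solution _ _ _ A G x u) //.
rewrite xt0 mulmx0 add0r mulmx_sumr big1 // => s _.
by rewrite !mulmxA aAG0 mul0mx.
Qed.

(* Only the two leading coefficients of the annihilating relation of [A] are
   used: the window shifted by [n] alone reaches the input block [n], and the
   block [n - 1] is then reached through [G] only. *)
Lemma exciting_left_kernel (F : fieldType) (n q N : nat) (A : 'M[F]_n)
    (G : 'M[F]_(n, q)) (x : nat -> 'cV[F]_n) (u : nat -> 'cV[F]_q)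
    (a : 'rV[F]_n) (b : 'rV[F]_q) :
  (forall j, (j.+1 < N)%N -> x j.+1 = A *m x j + G *m u j) ->
  (forall beta : nat -> 'rV[F]_q,
     (forall j, (j + n < N)%N -> \sum_(k < n.+1) beta k *m u (j + k)%N = 0) ->
     forall k, (k <= n)%N -> beta k = 0) ->
  (forall j, (j < N)%N -> a *m x j + b *m u j = 0) ->
  a *m G = 0 /\ b = 0.
Proof.
move=> xS exc ker; have [c cn1 cA0] := mx_power_relation A.
(* Once [x (k + i)] is expanded from [x k], [gam i s] is the coefficient of [u (k + s)] in
   [a *m x (k + i) + b *m u (k + i)]. Weighting by [c] cancels the terms in [x k], so [beta]
   annihilates every window of [n.+1] inputs. *)
pose gam i s : 'rV[F]_q :=
  if (s < i)%N then a *m A ^+ (i.-1 - s) *m G else if s == i then b else 0.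
pose beta s := \sum_(i < n.+1) c i *: gam i s.
have beta0 k : (k <= n)%N -> beta k = 0.
  apply: exc => {}k lt_kN.
  transitivity (\sum_(i < n.+1) c i *: (a *m x (k + i)%N + b *m u (k + i)%N)
    - a *m (\sum_(i < n.+1) c i *: A ^+ i) *m x k); last first.
    rewrite cA0 mulmx0 mul0mx subr0 big1 // => i _.
    by rewrite ker ?scaler0 // (leq_ltn_trans _ lt_kN) // leq_add2l -ltnS.
  under eq_bigr do rewrite /beta mulmx_suml.
  rewrite exchange_big /= mulmx_sumr mulmx_suml -sumrB.
  apply: eq_bigr => i _.
  have le_in : (i <= n)%N by rewrite -ltnS.
  rewrite (@state_solution _ _ _ A G x u) => [|s /andP[_ lt_s]]; last first.
    by rewrite xS // (leq_ltn_trans _ lt_kN) // (leq_trans lt_s) ?leq_add2l.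
  under eq_bigr do rewrite -scalemxAl.
  rewrite -scaler_sumr -scalemxAr -scalemxAl -scalerBr; congr (_ *: _).
  rewrite mulmxDr mulmxA addrAC [a *m _ *m x k + _]addrC addrK.
  rewrite mulmx_sumr -(big_mkord xpredT (fun s => gam i s *m u (k + s)%N)).
  rewrite (big_cat_nat _ (n := i)) ?(leqW le_in) //=; congr (_ + _).
    rewrite big_mkord; apply: eq_bigr => s _.
    by rewrite /gam ltn_ord !mulmxA.
  rewrite big_ltn ?ltnS // /gam ltnn eqxx big_nat big1 ?addr0 //.
  move=> s /andP[lt_is _].
  by rewrite ltnNge (ltnW lt_is) /= gtn_eqF ?mul0mx.
(* Input block [n] occurs only for [i = n], with weight [c n = 1]: [beta n = b]. *)
have b0 : b = 0.
  move: (beta0 n (leqnn n)); rewrite /beta big_ord_recr /= cn1 scale1r.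
  rewrite {2}/gam ltnn eqxx big1 ?add0r // => i _.
  by rewrite /gam ltnNge (ltnW (ltn_ord i)) gtn_eqF ?scaler0.
split=> //; have [n0 | n_gt0] := posnP n.
  apply/rowP => s; rewrite !mxE big1 // => -[i lt_in].
  by exfalso; rewrite n0 in lt_in.
move: (beta0 n.-1 (leq_pred n)); rewrite /beta big_ord_recr /= cn1 scale1r.
rewrite {2}/gam ltn_predL n_gt0 subnn mulmx1 big1 ?add0r // => i _.
by rewrite /gam b0 if_same ltnNge -ltnS prednK // ltn_ord scaler0.
Qed.

(** * Observability, minimality and controllability *)

Definition observable (F : fieldType) (n p : nat) (A : 'M[F]_n)
    (C : 'M[F]_(p, n)) : Prop :=
  forall z : 'cV[F]_n, (forall i, (i < n)%N -> C *m A ^+ i *m z = 0) -> z = 0.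

Lemma observable_free_motion (F : fieldType) (n p : nat) (A : 'M[F]_n)
    (C : 'M[F]_(p, n)) (z : nat -> 'cV[F]_n) (t : nat) :
  observable A C ->
  (forall s, (t <= s < t + n)%N -> z s.+1 = A *m z s /\ C *m z s = 0) ->
  z t = 0.
Proof.
move=> obs zP; apply: obs => i lt_in.
have [|_ <-] := zP (t + i)%N; first by rewrite leq_addr ltn_add2l.
rewrite (@state_solution _ _ 0 A 0 z (fun=> 0)) => [|s /andP[le_ts lt_s]].
  by rewrite big1 ?addr0 ?mulmxA // => s _; rewrite mulmx0.
have [|-> _] := zP s; last by rewrite mulmx0 addr0.
by rewrite le_ts (ltn_trans lt_s) // ltn_add2l.
Qed.

(* The state [x] is replaced by [row_base V *m x], which still determines the
   output. *)
Lemma iso_rep_restrict (R : realType) (m p n : nat) (A : 'M[R]_n)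
    (Bu : 'M[R]_(n, m)) (C : 'M[R]_(p, n)) (D : 'M[R]_(p, m)) (V : 'M[R]_n) :
  (C <= V)%MS -> (V *m A <= V)%MS ->
  has_iso_rep (iso_behaviour A Bu C D) (\rank V).
Proof.
move=> CV VA.
have [E [Er [EErK EA CE]]] :
    exists (E : 'M[R]_(\rank V, n)) (Er : 'M[R]_(n, \rank V)),
    [/\ E *m Er = 1%:M, E *m A *m Er *m E = E *m A & C *m Er *m E = C].
  exists (row_base V), (pinvmx (row_base V)).
  split; first by rewrite mulmxVp ?row_base_free.
    by rewrite mulmxKpV // (eqmxMr _ (eq_row_base V)) eq_row_base.
  by rewrite mulmxKpV // eq_row_base.
exists (E *m A *m Er), (E *m Bu), (C *m Er), D.
apply/seteqP; split=> w [x xP].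
  exists (fun t => E *m x t) => t; have [-> ->] := xP t.
  by rewrite mulmxDr !mulmxA EA CE.
(* A full state is obtained by running the original recursion from a lift of the reduced initial
   state; [E] projects it back to [x]. *)
pose z t := iteri t (fun s zs => A *m zs + Bu *m usubmx (w s)) (Er *m x 0%N).
have Ez t : E *m z t = x t.
  elim: t => [|t IHt]; first by rewrite /z /= mulmxA EErK mul1mx.
  by rewrite (xP t).1 /= mulmxDr -IHt !mulmxA EA.
by exists z => t; split=> //; rewrite (xP t).2 -Ez mulmxA CE.
Qed.

(** The row space [V] of the observability matrix contains the rows of [C] and is stable under [A],
    so it carries a representation of dimension [\rank V]. Minimality makes [V] full, and [V]
    annihilates [z]. *)
Lemma minimal_observable (R : realType) (m p n : nat) (A : 'M[R]_n)
    (Bu : 'M[R]_(n, m)) (C : 'M[R]_(p, n)) (D : 'M[R]_(p, m)) :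
  (forall n', has_iso_rep (iso_behaviour A Bu C D) n' -> (n <= n')%N) ->
  observable A C.
Proof.
move=> minA z CAz; pose V : 'M[R]_n := (\sum_(i < n) <<C *m A ^+ i>>)%MS.
have CAV i : (C *m A ^+ i <= V)%MS.
  rewrite submxE; apply/eqP; apply: mx_power_vanish i => i lt_in.
  by apply/eqP; rewrite -submxE (sumsmx_sup (Ordinal lt_in)) ?genmxE.
have CV : (C <= V)%MS by rewrite -[C]mulmx1 (CAV 0%N).
have VA : (V *m A <= V)%MS.
  rewrite sumsmxMr; apply/sumsmx_subP => i _.
  by rewrite (eqmxMr _ (genmxE _)) -mulmxA mulmxE -exprSr CAV.
have fullV : row_full V.
  by rewrite /row_full eqn_leq rank_leq_col minA //; apply: iso_rep_restrict.
have /(submx_trans (submx_full 1%:M fullV)) : (V <= kermx z)%MS.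
  apply/sumsmx_subP => i _; rewrite genmxE sub_kermx.
  by rewrite CAz ?eqxx.
by rewrite sub_kermx mul1mx => /eqP.
Qed.

(* Behavioural controllability only compares trajectories from time 1 on, so it
   does not make [(A, Bu)] controllable (take [m = 0], [A = 0], [C = 1]), but it
   places the state at time 1 in the reachable subspace. *)
Lemma controllable_state1 (R : realType) (m p n : nat) (A : 'M[R]_n)
    (Bu : 'M[R]_(n, m)) (C : 'M[R]_(p, n)) (D : 'M[R]_(p, m))
    (w : nat -> 'cV[R]_(m + p)) (x : nat -> 'cV[R]_n) (a : 'rV[R]_n) :
  observable A C -> controllable (iso_behaviour A Bu C D) ->
  (forall t, x t.+1 = A *m x t + Bu *m usubmx (w t) /\
             dsubmx (w t) = C *m x t + D *m usubmx (w t)) ->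
  (forall i, a *m A ^+ i *m Bu = 0) -> a *m x 1%N = 0.
Proof.
move=> obs ctr xP aAB0.
(* [w'] steers from the zero trajectory to [w]; length [n.+1] keeps the initial window nonempty when
   [n = 0]. *)
have [||w' [T' [[x' x'P] T'_gt0 w'0 w'w]]] := ctr n.+1 (fun=> 0) w isT.
- exists (fun=> 0) => //; exists (fun=> 0) => t.
  by rewrite !linear0 !addr0.
- by exists x.
have x'1 : x' 1%N = 0.
  apply: (observable_free_motion obs) => s /andP[s_gt0 lt_s].
  have ws0 : w' s = 0.
    by case: s s_gt0 lt_s => // s _ lt_s; apply: (w'0 (Ordinal (ltnW lt_s))).
  have [-> ] := x'P s; rewrite ws0 !linear0 !addr0 => CX.
  by rewrite -CX.
(* From time 1 on, [z] is a free motion with zero output; hence [x 1] is a state that [x'] reaches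
   from zero. *)
pose z s := x' (n.+1 + T' + s)%N - x s.
have /eqP : z 1%N = 0.
  apply: (observable_free_motion obs) => s /andP[s_gt0 _].
  have ws : w' (n.+1 + T' + s)%N = w s.
    rewrite w'w; first by rewrite -subnDA addKn.
    by rewrite -[ltnLHS]addn0 ltn_add2l.
  have [zS Cz] := x'P (n.+1 + T' + s)%N; have [xS Cx] := xP s.
  rewrite /z addnS zS xS ws mulmxBr opprD addrACA subrr addr0; split=> //.
  rewrite mulmxBr; apply/eqP; rewrite subr_eq0; apply/eqP.
  by apply: (addIr (D *m usubmx (w s))); rewrite -Cx -ws -Cz.
rewrite subr_eq0 => /eqP <-.
apply: (@state_annihilator _ _ _ _ A Bu a x' (fun t => usubmx (w' t)) 1
  (n + T' + 1)) => // s.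
by have [] := x'P s.
Qed.

(** * Duality and combinations of pages *)

(** Finite-dimensional duality: the rows [c] to test are those of the transposed cokernel of
    [H^T]. *)
Lemma annihilator_comb (F : fieldType) (r N : nat) (h : 'I_N -> 'cV[F]_r)
    (t : 'cV[F]_r) :
  (forall c : 'rV[F]_r, (forall j, c *m h j = 0) -> c *m t = 0) ->
  exists g : 'cV[F]_N, \sum_j g j 0 *: h j = t.
Proof.
move=> ann; pose H := \matrix_(s < r, j < N) h j s 0.
have colH c j : (c *m H) 0 j = (c *m h j) 0 0 :> F.
  by rewrite !mxE; apply: eq_bigr => s _; rewrite !mxE.
have : (t^T <= H^T)%MS.
  rewrite submxE; apply/eqP/trmx_inj; rewrite trmx_mul trmxK trmx0.
  apply/row_matrixP => i; rewrite row_mul row0; apply: ann => j.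
  apply/rowP => k; rewrite ord1 -colH -row_mul -[H in _ *m H]trmxK -trmx_mul.
  by rewrite mulmx_coker trmx0 row0 !mxE.
case/submxP => d td; exists d^T; apply/trmx_inj; rewrite td.
apply/rowP => s; rewrite !mxE summxE; apply: eq_bigr => j _.
by rewrite !mxE.
Qed.

(** Linearity and time invariance at the level of states, used in both directions of the theorem. *)
Lemma iso_motion_comb (R : realType) (m p n : nat) (A : 'M[R]_n)
    (Bu : 'M[R]_(n, m)) (C : 'M[R]_(p, n)) (D : 'M[R]_(p, m))
    (w : nat -> 'cV[R]_(m + p)) (x : nat -> 'cV[R]_n)
    (J : finType) (g : J -> R) (tau : J -> nat) :
  (forall t, x t.+1 = A *m x t + Bu *m usubmx (w t) /\
             dsubmx (w t) = C *m x t + D *m usubmx (w t)) ->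
  let z t := \sum_j g j *: x (t + tau j)%N in
  let v t := \sum_j g j *: w (t + tau j)%N in
  forall t, z t.+1 = A *m z t + Bu *m usubmx (v t) /\
            dsubmx (v t) = C *m z t + D *m usubmx (v t).
Proof.
move=> xP z v t; rewrite /z /v !linear_sum /= -!big_split /=.
split; apply: eq_bigr => j _; have [xS wE] := xP (t + tau j)%N.
  by rewrite addSn xS [usubmx (_ *: _)]linearZ /= -!scalemxAr scalerDr.
rewrite [dsubmx (_ *: _)]linearZ [usubmx (_ *: _)]linearZ /= wE.
by rewrite -!scalemxAr scalerDr.
Qed.

Lemma stack_inj (R : realType) (q L : nat) (u v : 'I_L -> 'cV[R]_q) :
  stack u = stack v -> forall i, u i = v i.
Proof. by move/eq_mxcolP. Qed.

Lemma stack_comb (R : realType) (q L : nat) (J : finType) (g : J -> R)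
    (h : J -> 'I_L -> 'cV[R]_q) :
  \sum_j g j *: stack (h j) = stack (fun i => \sum_j g j *: h j i).
Proof.
apply/colP => s; rewrite !mxE !summxE; apply: eq_bigr => j _.
by rewrite !mxE.
Qed.

Lemma page_mx_mul (R : realType) (q T L : nat) (u : 'I_T -> 'cV[R]_q)
    (g : 'cV[R]_(T %/ L)) :
  page_mx L u *m g = stack (fun i => \sum_j g j 0 *: u (page_index j i)).
Proof.
rewrite mxcol_mul; apply: eq_mxcol => i; apply/colP => r.
by rewrite !mxE summxE; apply: eq_bigr => j _; rewrite !mxE mulrC.
Qed.

Lemma page_mx_eqP (R : realType) (m p T L : nat) (uh : 'I_T -> 'cV[R]_m)
    (yh : 'I_T -> 'cV[R]_p) (u : 'I_L -> 'cV[R]_m) (y : 'I_L -> 'cV[R]_p)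
    (g : 'cV[R]_(T %/ L)) :
  col_mx (page_mx L uh) (page_mx L yh) *m g = col_mx (stack u) (stack y) <->
  forall i, \sum_j g j 0 *: col_mx (uh (page_index j i)) (yh (page_index j i)) =
            col_mx (u i) (y i).
Proof.
have colE i :
    \sum_j g j 0 *: col_mx (uh (page_index j i)) (yh (page_index j i)) =
    col_mx (\sum_j g j 0 *: uh (page_index j i))
           (\sum_j g j 0 *: yh (page_index j i)).
  rewrite -[LHS]vsubmxK !linear_sum /=; congr col_mx;
  by apply: eq_bigr => j _; rewrite linearZ /= ?col_mxKu ?col_mxKd.
rewrite mul_col_mx !page_mx_mul.
split=> [/eq_col_mx[/stack_inj Eu /stack_inj Ey] i|E]; first by rewrite colE Eu Ey.
congr col_mx; apply: eq_mxcol => i;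
by have := E i; rewrite colE => /eq_col_mx[].
Qed.

(** Puts page excitation in the form that [exciting_left_kernel] assumes: the [beta k] side by side
    form a left null vector of the stacked Page matrices. *)
Lemma page_exciting_blocks (R : realType) (m T L n : nat)
    (uh : 'I_T -> 'cV[R]_m) (u : nat -> 'cV[R]_m)
    (beta : nat -> 'rV[R]_(\sum_(i < L) m)) :
  (forall i : 'I_T, uh i = u i) -> page_exciting L n.+1 uh ->
  (forall j, (j + n < T %/ L)%N ->
     \sum_(k < n.+1)
       beta k *m stack (fun i : 'I_L => u ((j + k) * L + i)%N) = 0) ->
  forall k, (k <= n)%N -> beta k = 0.
Proof.
move=> uhE exc beta0 k le_kn.
have : (\mxrow_(k < n.+1) beta k) *m
       (\mxcol_(k < n.+1) page_mx L (window (L := L) uh k)) = 0.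
  rewrite mul_mxrow_mxcol; apply/rowP => j.
  (* A window of length [T - n * L] has [T %/ L - n] pages. *)
  have lt_j : (j + n < T %/ L)%N.
    by rewrite addnC -ltn_subRL -divnBMl ltn_ord.
  have /matrixP/(_ 0 0) := beta0 j lt_j.
  rewrite !mxE !summxE => E0; rewrite -[RHS]E0; apply: eq_bigr => k' _.
  rewrite !mxE; apply: eq_bigr => s _; rewrite !mxE.
  by rewrite /window uhE /= mulnDl addnCA addnA.
move/eqP; rewrite mulmx_free_eq0 // => /eqP.
by rewrite -[RHS]mxrow0 => /eq_mxrowP/(_ (Ordinal (le_kn : (k < n.+1)%N))).
Qed.

(** * The theorem for an observable representation *)

Lemma page_image (R : realType) (m p n : nat) (A : 'M[R]_n)
    (Bu : 'M[R]_(n, m)) (C : 'M[R]_(p, n)) (D : 'M[R]_(p, m))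
    (L T : nat) (uh : 'I_T -> 'cV[R]_m) (yh : 'I_T -> 'cV[R]_p)
    (u : 'I_L -> 'cV[R]_m) (y : 'I_L -> 'cV[R]_p) :
  observable A C -> controllable (iso_behaviour A Bu C D) ->
  (0 < L)%N -> (n <= L)%N -> page_exciting L n.+1 uh ->
  restricted (iso_behaviour A Bu C D) (fun i => col_mx (uh i) (yh i)) ->
  restricted (iso_behaviour A Bu C D) (fun i => col_mx (u i) (y i)) <->
  exists g : 'cV[R]_(T %/ L),
    col_mx (page_mx L uh) (page_mx L yh) *m g = col_mx (stack u) (stack y).
Proof.
move=> obs ctr L_gt0 le_nL exc [wh [xh xhP] whE]; split; last first.
  case=> g /page_mx_eqP gE.
  exists (fun t => \sum_(j < T %/ L) g j 0 *: wh (t + j * L)%N).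
    exists (fun t => \sum_(j < T %/ L) g j 0 *: xh (t + j * L)%N).
    exact: iso_motion_comb.
  move=> i; rewrite -gE; apply: eq_bigr => j _.
  by rewrite whE /= [(j * L + i)%N]addnC.
case=> w [x xP] wE.
pose U (v : nat -> 'cV[R]_(m + p)) k :=
  stack (fun i : 'I_L => usubmx (v (k * L + i).+1)).
have [g gE] : exists g : 'cV[R]_(T %/ L),
    \sum_(j < T %/ L) g j 0 *: col_mx (xh (j * L).+1) (U wh j) =
    col_mx (x 1%N) (U w 0%N).
  apply: annihilator_comb => c; rewrite -[c]hsubmxK.
  move: (lsubmx c) (rsubmx c) => a b ker; rewrite mul_row_col.
  (* [G] sends a stacked input page to its effect on the state at the start of the next page. *)
  pose G := \mxrow_(i < L) (A ^+ (L.-1 - i) *m Bu).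
  have [||j lt_j|aG0 ->] := @exciting_left_kernel _ _ _ (T %/ L) (A ^+ L) G
      (fun j => xh (j * L).+1) (U wh) a b.
  - move=> j _; rewrite mulSn addnC -addSn.
    rewrite (@state_solution _ _ _ A Bu xh (fun t => usubmx (wh t))).
      by rewrite mul_mxrow_mxcol.
    by move=> s _; have [] := xhP s.
  - move=> beta.
    apply: (page_exciting_blocks (u := fun t => usubmx (wh t.+1))) exc.
    by move=> i; rewrite -whE col_mxKu.
  - by have := ker (Ordinal lt_j); rewrite mul_row_col.
  rewrite mul0mx addr0 (controllable_state1 obs ctr xP) //.
  (* As [n <= L], each [a *m A ^+ i *m Bu] with [i < n] is a block of [a *m G], at position
     [L.-1 - i]. *)
  apply: mx_power_vanish => i lt_in.
  have lt_iL : (L.-1 - i < L)%N.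
    by rewrite (leq_ltn_trans (leq_subr _ _)) ?ltn_predL.
  move: aG0; rewrite mul_mxrow -[RHS]mxrow0.
  move/eq_mxrowP/(_ (Ordinal lt_iL)) => /=.
  by rewrite subKn ?mulmxA // -ltnS prednK // (leq_trans lt_in).
exists g; apply/page_mx_eqP => i.
(* [v] with state [z] agrees with [w] in the state at time 1 and in the inputs at times 1 to [L],
   hence also in the outputs there. *)
pose z t := \sum_(j < T %/ L) g j 0 *: xh (t + j * L)%N.
pose v t := \sum_(j < T %/ L) g j 0 *: wh (t + j * L)%N.
have zP t : z t.+1 = A *m z t + Bu *m usubmx (v t) /\
            dsubmx (v t) = C *m z t + D *m usubmx (v t).
  exact: iso_motion_comb.
have z1 : z 1%N = x 1%N.
  rewrite -(col_mxKu (x 1%N) (U w 0%N)) -gE linear_sum; apply: eq_bigr => j _.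
  by rewrite linearZ /= col_mxKu.
have uE k : (k < L)%N -> usubmx (v k.+1) = usubmx (w k.+1).
  move=> lt_kL; suff /stack_inj/(_ (Ordinal lt_kL)) :
      stack (fun i : 'I_L => usubmx (v i.+1)) =
      stack (fun i : 'I_L => usubmx (w i.+1)) by [].
  rewrite -[RHS]/(U w 0%N).
  rewrite -(col_mxKd (x 1%N) (U w 0%N)) -gE linear_sum /=.
  transitivity (\sum_(j < T %/ L) g j 0 *: U wh j); last first.
    by apply: eq_bigr => j _; rewrite [dsubmx (_ *: _)]linearZ /= col_mxKd.
  rewrite stack_comb; apply: eq_mxcol => i'; rewrite linear_sum /=.
  by apply: eq_bigr => j _; rewrite linearZ /= addSn [(i' + _)%N]addnC.
have zE k : (k < L)%N -> z k.+1 = x k.+1.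
  elim: k => [|k IHk] lt_kL //; rewrite (zP _).1 (xP _).1.
  by rewrite IHk ?uE // ltnW.
have -> : col_mx (u i) (y i) = v i.+1.
  rewrite wE -[LHS]vsubmxK -[RHS]vsubmxK uE //; congr col_mx.
  by rewrite (xP _).2 (zP _).2 zE ?uE.
by apply: eq_bigr => j _; rewrite whE /= [(j * L + i)%N]addnC.
Qed.

Theorem mainTheorem1 (R : realType) (m p : nat) (B : behaviour R m p)
    (B_lti : lti B)
    (B_rep : exists n : nat, has_iso_rep B n)
    (B_controllable : controllable B)
    (L T : nat) (L_gt0 : (0 < L)%N) (T_gt0 : (0 < T)%N)
    (L_ge : (state_order B <= L)%N)
    (uh : 'I_T -> 'cV[R]_m) (yh : 'I_T -> 'cV[R]_p)
    (uyh_traj : restricted B (fun i => col_mx (uh i) (yh i)))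
    (uh_exciting : page_exciting L (state_order B).+1 uh)
    (u : 'I_L -> 'cV[R]_m) (y : 'I_L -> 'cV[R]_p) :
  restricted B (fun i => col_mx (u i) (y i)) <->
  exists g : 'cV[R]_(T %/ L),
    col_mx (page_mx L uh) (page_mx L yh) *m g = col_mx (stack u) (stack y).
Proof.
have [[A [Bu [C [D BE]]]] min_order] := state_orderP B_rep.
move: (state_order B) A Bu C D BE min_order L_ge uh_exciting.
move=> n A Bu C D BE min_order le_nL exc.
have obs : observable A C.
  by apply: (minimal_observable (Bu := Bu) (D := D)); rewrite -BE.
by rewrite BE in B_controllable uyh_traj *; apply: page_image exc uyh_traj.
Qed.
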